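(* Let $n \ge 4$ be an integer and let $p/q$ and $r/s$ be Farey neighbors of order $n$, with $q < s$, such that $\lfloor n/q \rfloor = 1$ and \[ 0 < \min\left\{ \frac{p}{q}, \frac{r}{s} \right\} < \max\left\{ \frac{p}{q}, \frac{r}{s} \right\} < \frac{1}{2}. \] For $\alpha \in [0,1]$ let \[ P_\alpha(t) = t^s - (1-\alpha)\, t^{s-q} - \alpha. \] Then there is a continuous function $\lambda : [0,1] \to \mathbb{C}$ such that $\lambda(0) = \omega_q^p$, $\lambda(1) = \omega_s^r$, and $P_\alpha(\lambda(\alpha)) = 0$ for all $\alpha \in [0,1]$. Furthermore, \[ \min\left\{ \frac{p}{q}, \frac{r}{s} \right\} \le \frac{\operatorname{Arg} \lambda(\alpha)}{2\pi} \le \max\left\{ \frac{p}{q}, \frac{r}{s} \right\} \quad \text{for all } \alpha \in (0,1). \]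
   Context: For $k \in \mathbb{N}$, $\omega_k = \cos(2\pi/k) + i \sin(2\pi/k)$. For a nonzero complex number $z$, $\operatorname{Arg} z$ is the argument of $z$ lying in $(-\pi,\pi]$. The Farey fractions of order $n$ are the elements of $F_n = \{ p/q : 0 \le p \le q \le n,\ \gcd(p,q) = 1 \}$ (always written in lowest terms $p/q$). Two elements $x<y$ of $F_n$ form a Farey pair $(x,y)$ of order $n$ if no element of $F_n$ lies strictly between $x$ and $y$; two Farey fractions $p/q$ and $r/s$ are Farey neighbors of order $n$ if $(p/q, r/s)$ or $(r/s, p/q)$ is a Farey pair of order $n$. The polynomial $P_\alpha$ is called the Type I (reduced) Ito polynomial. *)

(* Defs.v *)
From HB Require Import structures.
From mathcomp Require Import all_boot all_order all_algebra.
From mathcomp Require Import complex.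
From mathcomp Require Import all_classical all_reals all_analysis.

Set Implicit Arguments.
Unset Strict Implicit.
Unset Printing Implicit Defensive.

Import Order.TTheory GRing.Theory Num.Theory.
Import numFieldNormedType.Exports.

Local Open Scope classical_set_scope.
Local Open Scope ring_scope.
Local Open Scope complex_scope.

(* [p / q] is an element of F_n written in lowest terms; [coprime p q] and
   [p <= q] rule out [q = 0]. *)
Definition farey_fraction (n p q : nat) : bool :=
  [&& (p <= q)%N, (q <= n)%N & coprime p q].

Definition farey (n : nat) : set rat :=
  [set x | exists p q : nat, farey_fraction n p q /\ x = p%:R / q%:R].

Definition farey_pair (n : nat) (x y : rat) : Prop :=
  [/\ farey n x, farey n y, x < y
    & ~ exists z, farey n z /\ x < z < y].

Definition farey_neighbors (n p q r s : nat) : Prop :=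
  [/\ farey_fraction n p q, farey_fraction n r s
    & farey_pair n (p%:R / q%:R) (r%:R / s%:R) \/
      farey_pair n (r%:R / s%:R) (p%:R / q%:R)].

Definition omega (R : realType) (k : nat) : R[i] :=
  cos (2 * pi / k%:R) +i* sin (2 * pi / k%:R).

Definition is_argument (R : realType) (z : R[i]) (theta : R) : Prop :=
  z = `|z| * (cos theta +i* sin theta).

(* The value at [z = 0] is arbitrary; see [ArgP] and [Arg_uniq] below. *)
Definition Arg (R : realType) (z : R[i]) : R :=
  xget 0 [set theta | - pi < theta <= pi /\ is_argument z theta].

Definition ito_poly (R : realType) (q s : nat) (alpha : R) : {poly R[i]} :=
  'X^s - (1 - alpha)%:C *: 'X^(s - q) - (alpha%:C)%:P.

Lemma is_argument_ex (R : realType) (z : R[i]) : z != 0 ->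
  exists theta : R, - pi < theta <= pi /\ is_argument z theta.
Proof.
case: z => a b z0; rewrite /is_argument normc_def /=.
set r := Num.sqrt _.
have r2 : r ^+ 2 = a ^+ 2 + b ^+ 2.
  by rewrite sqr_sqrtr // addr_ge0 // sqr_ge0.
have r_gt0 : 0 < r.
  rewrite sqrtr_gt0 lt_neqAle addr_ge0 ?sqr_ge0 // andbT eq_sym.
  apply: contra z0; rewrite paddr_eq0 ?sqr_ge0 // !sqrf_eq0.
  by move=> /andP[/eqP-> /eqP->].
have rn0 : r != 0 by rewrite gt_eqF.
have ar : `|a / r| <= 1.
  rewrite normrM normfV (gtr0_norm r_gt0) ler_pdivrMr // mul1r.
  rewrite -ler_sqr ?nnegrE ?(ltW r_gt0) // r2 real_normK ?num_real //.
  by rewrite lerDl sqr_ge0.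
have ar' : -1 <= a / r <= 1 by rewrite -ler_norml.
have sE : r * sin (acos (a / r)) = `|b|.
  rewrite sin_acos //.
  have -> : 1 - (a / r) ^+ 2 = (b / r) ^+ 2.
    rewrite !expr_div_n; apply: (mulIf (expf_neq0 2 rn0)).
    by rewrite mulrBl mul1r !divfK ?expf_neq0 // r2 addrAC subrr add0r.
  by rewrite sqrtr_sqr normrM normfV (gtr0_norm r_gt0) mulrC divfK.
have cE : r * cos (acos (a / r)) = a by rewrite acosK ?in_itv // mulrC divfK.
have [b0|b0] := leP 0 b.
  exists (acos (a / r)); split.
    rewrite acos_lepi // andbT (lt_le_trans _ (acos_ge0 ar')) //.
    by rewrite oppr_lt0 pi_gt0.
  by apply/eqP; rewrite eq_complex /= !mul0r subr0 addr0 cE sE ger0_norm ?eqxx.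
exists (- acos (a / r)); split.
  apply/andP; split; last first.
    by rewrite (le_trans _ (pi_ge0 R)) // oppr_le0 acos_ge0.
  rewrite ltrN2 lt_neqAle acos_lepi // andbT; apply/eqP => h.
  move: sE; rewrite h sinpi mulr0 => /esym/eqP.
  by rewrite normr_eq0 (lt_eqF b0).
apply/eqP; rewrite eq_complex /= !mul0r subr0 addr0 cosN sinN mulrN cE sE.
by rewrite ltr0_norm // opprK !eqxx.
Qed.

Lemma ArgP (R : realType) (z : R[i]) : z != 0 ->
  - pi < Arg z <= pi /\ is_argument z (Arg z).
Proof.
by move=> /is_argument_ex[t ht]; rewrite /Arg; case: xgetP => [y ->|/(_ t)].
Qed.

Lemma Arg_uniq (R : realType) (z : R[i]) (theta : R) : z != 0 ->
  - pi < theta <= pi -> is_argument z theta -> Arg z = theta.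
Proof.
move=> z0 tI tz; have [aI az] := ArgP z0; set a := Arg z in aI az *.
have /eqP := etrans (esym az) tz.
rewrite (inj_eq (mulfI _)) ?normr_eq0 // eq_complex /= => /andP[/eqP ec /eqP es].
have half (u : R) : - pi < u <= pi -> 0 <= sin u -> 0 <= u.
  move=> /andP[u1 u2] su; rewrite leNgt; apply/negP => u0.
  have : 0 < sin (- u).
    by apply: sin_gt0_pi; rewrite /= oppr_gt0 u0 ltrNl.
  by rewrite sinN oppr_gt0 ltNge su.
have half' (u : R) : - pi < u <= pi -> sin u < 0 -> u <= 0.
  move=> /andP[u1 u2] su; rewrite leNgt; apply/negP => u0.
  have : 0 <= sin u by apply: sin_ge0_pi; rewrite /= (ltW u0).
  by rewrite leNgt su.
have [s0|s0] := leP 0 (sin a).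
  have st : 0 <= sin theta by rewrite -es.
  apply: cos_inj => //; rewrite in_itv /= half //.
    by case/andP: aI.
  by case/andP: tI.
have st : sin theta < 0 by rewrite -es.
apply: oppr_inj; apply: cos_inj; last by rewrite !cosN.
  by rewrite in_itv /= oppr_ge0 half' // lerNl ltW //; case/andP: aI.
by rewrite in_itv /= oppr_ge0 half' // lerNl ltW //; case/andP: tI.
Qed.

(* Main.v *)
(** Write [t = rho e^(i theta)] with [theta = 2 pi p / q + eps x], where
    [eps = r q - p s], which is [1] or [-1] for Farey neighbors, and
    [0 <= x <= c / s] with [c = 2 pi / q].  Then [P_a(t) = 0] says that sides of
    lengths [(1 - a) / rho ^ q] and [a / rho ^ s], making angles [q x] and
    [c - s x] with a side of length [1], close up to a triangle.  By the law of
    sines and after eliminating [rho], with [d = s - q],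
      [a ^ q sin(c - s x) ^ s = (1 - a) ^ s sin(q x) ^ q sin(c - d x) ^ d].
    The quotient [sin(q x) ^ q sin(c - d x) ^ d / sin(c - s x) ^ s] is strictly
    increasing in [x], because the numerator of its logarithmic derivative is a
    sum of two squares, so [x] is a function of [a].  Both [x] and [rho] are the
    unique sign change of a function continuous in [a], hence are themselves
    continuous in [a]. *)

Require Import Defs.
From HB Require Import structures.
From mathcomp Require Import all_boot all_order all_algebra.
From mathcomp Require Import complex.
From mathcomp Require Import all_classical all_reals all_analysis.
From mathcomp Require Import zify ring lra.
Import Order.TTheory GRing.Theory Num.Theory.
Import numFieldNormedType.Exports.
Local Open Scope classical_set_scope.
Local Open Scope ring_scope.
Local Open Scope complex_scope.

(** * Determinants of Farey pairs *)

(** The [k] solving [b h - a k = 1] fill a residue class modulo [b], so one of them lies among the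
    [b] integers ending at [n]. The resulting [h / k] is the candidate for the successor of [a / b]
    in the Farey sequence of order [n]. *)
Lemma bezout_window (n a b : nat) : (0 < b <= n)%N -> coprime a b ->
  exists h k : nat, (b * h = a * k + 1)%N /\ (n - b < k <= n)%N.
Proof.
move=> /andP[b0 bn] cab.
have [u0 | u0] := posnP a.
  move: cab; rewrite u0 /coprime gcd0n => /eqP ->.
  by exists 1%N, n; split; lia.
have [[h k] /= e] : exists hk : nat * nat, (b * hk.1 = a * hk.2 + 1)%N.
  case: (egcdnP a b0) => h k e _; exists (h, k) => /=.
  by rewrite -[X in (_ + X)%N](eqP cab) gcdnC; lia.
pose k1 := (k %% b)%N; pose m := (k %/ b)%N.
have kE : k = (m * b + k1)%N by exact: divn_eq.
have k1b : (k1 < b)%N by rewrite ltn_mod.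
have e1 : (b * (h - m * a) = a * k1 + 1)%N by rewrite mulnBr e kE; lia.
pose j := ((n - k1) %/ b)%N.
have jE : (n - k1 = j * b + (n - k1) %% b)%N by exact: divn_eq.
have jb : ((n - k1) %% b < b)%N by rewrite ltn_mod.
exists (h - m * a + j * a)%N, (k1 + j * b)%N; split; last by lia.
by rewrite mulnDr e1; lia.
Qed.

Lemma ltr_nat_div (F : numFieldType) (a b c d : nat) : (0 < b)%N -> (0 < d)%N ->
  (a%:R / b%:R < c%:R / d%:R :> F) = (a * d < c * b)%N.
Proof.
by move=> b0 d0; rewrite ltr_pdivrMr ?ltr0n // mulrAC ltr_pdivlMr ?ltr0n //
  -!natrM ltr_nat.
Qed.

(** The fraction [h / k] of [bezout_window] exceeds [a / b] by [1 / (b k)]. It cannot lie strictly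
    inside the pair, so [c / d <= h / k]; the bound [k > n - b] excludes strict inequality, and
    equal fractions in lowest terms have equal parts. *)
Lemma farey_pair_det (n a b c d : nat) :
  farey_fraction n a b -> farey_fraction n c d ->
  farey_pair n (a%:R / b%:R) (c%:R / d%:R) -> (c * b = a * d + 1)%N.
Proof.
have den0 x y : farey_fraction n x y -> (0 < y)%N.
  by case: y => // /and3P[+ _]; rewrite leqn0 => /eqP->.
move=> fab fcd [_ _ lt_ab_cd nob].
have b0 := den0 _ _ fab; have d0 := den0 _ _ fcd.
have /and3P[leab lebn cab] := fab; have /and3P[lecd ledn ccd] := fcd.
move: lt_ab_cd; rewrite ltr_nat_div // => ltabcd.
have [h [k [e /andP[k1 k2]]]] := @bezout_window n a b (ltac:(lia)) cab.
have k0 : (0 < k)%N by lia.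
have ltab : (a < b)%N.
  rewrite -(ltn_pmul2r d0) (leq_trans ltabcd) // mulnC leq_mul2l lecd orbT //.
have hk : (h <= k)%N.
  rewrite leqNgt; apply/negP => kh.
  have h1 : (b * k.+1 <= b * h)%N by rewrite leq_mul2l kh orbT.
  have h2 : (a.+1 * k <= b * k)%N by rewrite leq_mul2r ltab orbT.
  by lia.
have chk : coprime h k.
  apply/eqP/eqP; rewrite -dvdn1.
  have := dvdn_gcdl h k; have := dvdn_gcdr h k; set g := gcdn h k => gk gh.
  by rewrite -(dvdn_addr 1 (dvdn_mull a gk)) -e dvdn_mull.
have : ~~ (h * d < c * k)%N.
  apply/negP => lthk; apply: nob; exists (h%:R / k%:R); split.
    by exists h, k; rewrite /farey_fraction hk k2 chk.
  by rewrite !ltr_nat_div // lthk andbT; lia.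
rewrite -leqNgt => lehk.
(* If [c / d < h / k], then [h d - c k] and [c b - a d] are both at least [1]; with [b h = a k + 1]
   this forces [d >= b + k > n]. *)
have eqhk : (h * d = c * k)%N.
  apply/eqP; rewrite eqn_leq lehk andbT leqNgt; apply/negP => lt1.
  have : (b * h * d = (a * k + 1) * d)%N by rewrite e.
  have h1 : (b * (c * k).+1 <= b * (h * d))%N by rewrite leq_mul2l lt1 orbT.
  have h2 : (k * (a * d).+1 <= k * (c * b))%N by rewrite leq_mul2l ltabcd orbT.
  lia.
have dk : (d %| k)%N.
  by rewrite -(Gauss_dvdr k (n := c)) 1?coprime_sym // -eqhk dvdn_mull.
have kd : (k %| d)%N.
  by rewrite -(Gauss_dvdr d (n := h)) 1?coprime_sym // eqhk dvdn_mull.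
have dkE : d = k by apply/eqP; rewrite eqn_dvd dk kd.
subst k; have hc : h = c by apply/eqP; rewrite -(eqn_pmul2r d0) eqhk.
by subst h; rewrite mulnC.
Qed.

(** * Continuity of functions located by a sign change *)

(** The strict signs of [F (g a - e)] and [F (g a + e)] at [a] persist nearby, since each [F x] is
    continuous, and they trap [g] within [e] of [g a]. Continuity of [F] in its first argument does
    not enter. *)
Lemma continuous_of_sign {R : realType} (g : R -> R) (F : R -> R -> R) :
  (forall x, continuous (F x)) ->
  (forall x a, (x < g a) = (0 < F x a)) ->
  (forall x a, (g a < x) = (F x a < 0)) ->
  continuous g.
Proof.
move=> cF gt_g lt_g a; apply/cvgrPdist_lt => e e0.
have h1 : 0 < F (g a - e) a by rewrite -gt_g ltrBlDr ltrDl.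
have h2 : F (g a + e) a < 0 by rewrite -lt_g ltrDl.
near=> y; rewrite ltr_distlC gt_g lt_g; apply/andP; split; near: y.
- exact: (cvgr_gt (F (g a - e) a) (cF (g a - e) a)).
- exact: (cvgr_lt (F (g a + e) a) (cF (g a + e) a)).
Unshelve. all: by end_near. Qed.

(** Retraction onto the unit interval, by which functions of a parameter in it extend continuously
    to the whole line. *)
Definition clamp01 {R : realType} (a : R) : R := Num.max 0 (Num.min a 1).

Lemma clamp01_id {R : realType} (a : R) : 0 <= a <= 1 -> clamp01 a = a.
Proof. by case/andP=> a0 a1; rewrite /clamp01 min_l // max_r. Qed.

Lemma clamp01_itv {R : realType} (a : R) : 0 <= clamp01 a <= 1.
Proof.
by rewrite /clamp01 le_max lexx /= ge_max ler01 /= ge_min lexx orbT.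
Qed.

Lemma continuous_clamp01 {R : realType} : continuous (@clamp01 R).
Proof.
move=> a; apply: (@continuous_max _ R (cst 0) (fun x => Num.min x 1)).
  exact: cvg_cst.
by apply: (@continuous_min _ R id (cst 1)); [exact: cvg_id|exact: cvg_cst].
Qed.

Lemma root_of_pos {R : realType} (k : nat) (y : R) : (0 < k)%N -> 0 < y ->
  exists2 x : R, 0 < x & x ^+ k = y.
Proof.
move=> k0 y0; exists (y `^ (k%:R^-1)); first exact: powR_gt0.
rewrite -powR_mulrn ?powR_ge0 // -powRrM mulVf ?powRr1 ?ltW //.
by rewrite pnatr_eq0 -lt0n.
Qed.

(** The hypothesis relating [N] and [M] is strict monotonicity of [N / M], cross-multiplied so that
    [M] may vanish. Multiplying the balance at [y] by [M x] or [N x] and using the equation at [x]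
    leaves [v] or [u] times such a cross difference. *)
Lemma balance_sign {R : realType} (T u v x y : R) (N M : R -> R) :
  (forall z, 0 <= z <= T -> 0 <= N z) ->
  (forall z, 0 <= z <= T -> 0 <= M z) ->
  (forall z w, 0 <= z -> z < w -> w <= T -> N z * M w < N w * M z) ->
  0 <= u -> 0 <= v -> 0 < u + v ->
  0 <= x <= T -> 0 <= y <= T -> u * M x = v * N x ->
  ((y < x) = (0 < u * M y - v * N y)) /\ ((x < y) = (u * M y - v * N y < 0)).
Proof.
move=> N0 M0 mono u0 v0 uv xT yT e.
have Nx := N0 _ xT; have Ny := N0 _ yT; have Mx := M0 _ xT; have My := M0 _ yT.
have [x0 x1] := andP xT; have [y0 y1] := andP yT.
set Z := u * M y - v * N y.
have pos_of (s t : R) : 0 <= s -> 0 < s * t -> 0 < t.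
  by move=> s0; rewrite le_eqVlt in s0; case/predU1P: s0 => [<-|s0];
    rewrite ?mul0r ?ltxx // pmulr_rgt0.
case: (ltgtP y x) => [yx|xy|yx].
- have m := mono _ _ y0 yx x1.
  suff Zp : 0 < Z by rewrite Zp ltNge ltW.
  have [v1|v1] := ltP 0 v.
    apply: (pos_of _ _ Mx); rewrite /Z.
    have -> : M x * (u * M y - v * N y) = v * (N x * M y - N y * M x).
      by rewrite mulrBr mulrCA mulrA [u * _]mulrC [M x * u]mulrC e; ring.
    by rewrite pmulr_rgt0 // subr_gt0.
  (* Here the balance is just [u * M y]; by [m] the product [N x * M y] exceeds a nonnegative
     number, hence [M y > 0]. *)
  have vE : v = 0 by apply/eqP; rewrite eq_le v0 v1.
  have u1 : 0 < u by move: uv; rewrite vE addr0.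
  rewrite /Z vE mul0r subr0 pmulr_rgt0 //; apply: (pos_of _ _ Nx).
  by apply: le_lt_trans m; rewrite mulr_ge0.
- have m := mono _ _ x0 xy y1.
  suff Zn : Z < 0 by rewrite Zn ltNge ltW.
  rewrite -oppr_gt0.
  have [u1|u1] := ltP 0 u.
    apply: (pos_of _ _ Nx); rewrite /Z.
    have -> : N x * - (u * M y - v * N y) = u * (N y * M x - N x * M y).
      rewrite [u * (_ - _)]mulrBr mulrCA e; ring.
    by rewrite pmulr_rgt0 // subr_gt0.
  have uE : u = 0 by apply/eqP; rewrite eq_le u0 u1.
  have v1 : 0 < v by move: uv; rewrite uE add0r.
  rewrite /Z uE mul0r sub0r opprK pmulr_rgt0 //; apply: (pos_of _ _ Mx).
  by rewrite mulrC; apply: le_lt_trans m; rewrite mulr_ge0.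
- by rewrite /Z yx e subrr ltxx.
Qed.

(** The zeros [N 0 = 0] and [M T = 0] give the end signs for the intermediate value theorem;
    [balance_sign] then makes the solution the unique sign change, so [continuous_of_sign]
    applies. *)
Lemma balance_continuous {R : realType} (T : R) (N M u v : R -> R) :
  0 < T -> continuous N -> continuous M -> continuous u -> continuous v ->
  (forall z, 0 <= z <= T -> 0 <= N z) ->
  (forall z, 0 <= z <= T -> 0 <= M z) ->
  N 0 = 0 -> M T = 0 ->
  (forall z w, 0 <= z -> z < w -> w <= T -> N z * M w < N w * M z) ->
  (forall a, 0 <= u a) -> (forall a, 0 <= v a) -> (forall a, 0 < u a + v a) ->
  exists f : R -> R, [/\ continuous f, forall a, 0 <= f a <= T,
    forall a, u a * M (f a) = v a * N (f a),
    forall a, u a = 0 -> f a = 0 & forall a, v a = 0 -> f a = T].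
Proof.
move=> T0 cN cM cu cv N0 M0 N00 MT mono u0 v0 uv.
have T00 : 0 <= (0 : R) <= T by rewrite lexx ltW.
have TT : 0 <= T <= T by rewrite lexx ltW.
have ex a : exists x : R, 0 <= x <= T /\ u a * M x = v a * N x.
  have [|||x xT xE] := @IVT R (fun x => u a * M x - v a * N x) 0 T 0.
  - exact: ltW.
  - apply: continuous_subspaceT => x.
    apply: cvgB.
      by apply: cvgM; [exact: cvg_cst|exact: cM].
    by apply: cvgM; [exact: cvg_cst|exact: cN].
  - rewrite N00 MT !mulr0 subr0 sub0r ge_min le_max oppr_le0.
    by rewrite (mulr_ge0 (u0 a) (M0 _ T00)) (mulr_ge0 (v0 a) (N0 _ TT)) orbT.
  by exists x; split; [rewrite in_itv in xT | apply/eqP; rewrite -subr_eq0 xE].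
have [f fP] := choice ex; exists f.
have sg a y := fun yT => @balance_sign R T (u a) (v a) (f a) y N M N0 M0 mono
  (u0 a) (v0 a) (uv a) (fP a).1 yT (fP a).2.
split; try by move=> a; case: (fP a).
(* Outside [[0, T]] the sign of the balance is unknown, so it is replaced by constants of the sign
   dictated by [0 <= f a <= T]. *)
- apply: (@continuous_of_sign R f (fun x a => if x < 0 then 1 else
    if T < x then -1 else u a * M x - v a * N x)).
  + move=> x /=; case: (x < 0); first by move=> a; exact: cvg_cst.
    case: (T < x); first by move=> a; exact: cvg_cst.
    move=> a; apply: cvgB.
      by apply: cvgM; [exact: cu|exact: cvg_cst].
    by apply: cvgM; [exact: cv|exact: cvg_cst].
  + move=> x a; have [/andP[f0 fT] _] := fP a.
    case: ifP => x0; first by rewrite ltr01 (lt_le_trans x0).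
    case: ifP => xT; first by rewrite ltr0N1 lt_gtF // (le_lt_trans fT).
    by case: (sg a x _) => //; rewrite leNgt x0 leNgt xT.
  + move=> x a; have [/andP[f0 fT] _] := fP a.
    case: ifP => x0; first by rewrite ltr10 lt_gtF // (lt_le_trans x0).
    case: ifP => xT; first by rewrite ltrN10 (le_lt_trans fT).
    by case: (sg a x _) => //; rewrite leNgt x0 leNgt xT.
- move=> a ua; have [/andP[f0 fT] _] := fP a; apply/eqP; rewrite eq_le f0 andbT.
  by rewrite leNgt (sg a 0 T00).1 ua N00 mul0r mulr0 subrr ltxx.
- move=> a va; have [/andP[f0 fT] _] := fP a; apply/eqP; rewrite eq_le fT /=.
  by rewrite leNgt (sg a T TT).2 va MT mul0r mulr0 subrr ltxx.
Qed.

(** The equation prevents [X a] and [Y a] from vanishing together, so its left side is strictly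
    increasing on nonnegative arguments and [r a] is its unique crossing of [1]. *)
Lemma trinomial_root_continuous {R : realType} (X Y r : R -> R) (j k : nat) :
  (0 < j)%N -> (0 < k)%N -> continuous X -> continuous Y ->
  (forall a, 0 <= X a) -> (forall a, 0 <= Y a) -> (forall a, 0 < r a) ->
  (forall a, X a * r a ^+ j + Y a * r a ^+ k = 1) -> continuous r.
Proof.
move=> j0 k0 cX cY X0 Y0 r0 e.
have mono a x y : 0 <= x -> x < y ->
    X a * x ^+ j + Y a * x ^+ k < X a * y ^+ j + Y a * y ^+ k.
  move=> x0 xy.
  have lt i : (0 < i)%N -> x ^+ i < y ^+ i.
    by move=> i0; rewrite ltrXn2r ?nnegrE ?(ltW (le_lt_trans x0 xy)) // lt0n_neq0.
  have Xle : X a * x ^+ j <= X a * y ^+ j by rewrite ler_wpM2l // ltW // lt.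
  have Yle : Y a * x ^+ k <= Y a * y ^+ k by rewrite ler_wpM2l // ltW // lt.
  have [X1|X1] := ltP 0 (X a); first by rewrite ltr_leD // ltr_pM2l // lt.
  have [Y1|Y1] := ltP 0 (Y a); first by rewrite ler_ltD // ltr_pM2l // lt.
  have XE : X a = 0 by apply/eqP; rewrite eq_le X1 X0.
  have YE : Y a = 0 by apply/eqP; rewrite eq_le Y1 Y0.
  by have /esym/eqP := e a; rewrite XE YE !mul0r addr0 oner_eq0.
have sg x a : 0 <= x ->
    ((x < r a) = (0 < 1 - (X a * x ^+ j + Y a * x ^+ k))) /\
    ((r a < x) = (1 - (X a * x ^+ j + Y a * x ^+ k) < 0)).
  move=> x0; rewrite subr_gt0 subr_lt0.
  case: (ltgtP x (r a)) => [xr|rx|->]; last by rewrite e ltxx.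
  - by have h := mono a _ _ x0 xr; rewrite e in h; rewrite h ltNge ltW.
  - by have h := mono a _ _ (ltW (r0 a)) rx; rewrite e in h; rewrite h ltNge ltW.
apply: (@continuous_of_sign R r (fun x a =>
  if x < 0 then 1 else 1 - (X a * x ^+ j + Y a * x ^+ k))).
- move=> x /=; case: (x < 0); first by move=> a; exact: cvg_cst.
  move=> a; apply: cvgB; first exact: cvg_cst.
  by apply: cvgD; apply: cvgM; [exact: cX|exact: cvg_cst|exact: cY|exact: cvg_cst].
- move=> x a; case: ifP => x0; first by rewrite ltr01 (lt_trans x0).
  by case: (sg x a _) => //; rewrite leNgt x0.
- move=> x a; case: ifP => x0; first by rewrite ltr10 lt_gtF // (lt_trans x0).
  by case: (sg x a _) => //; rewrite leNgt x0.
Qed.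

(** * The sine triangle and the curve of angles and moduli *)

(** These are two angles of the triangle and their sum [c - d x]. The sum stays positive even for
    degenerate triangles, because [c - d x >= q c / (q + d)]. *)
Lemma sine_triangle_bounds {R : realType} (q d : nat) (c x : R) :
  (0 < q)%N -> 0 < c < pi -> 0 <= x <= c / (q + d)%:R ->
  [/\ 0 <= q%:R * x, q%:R * x < pi, 0 <= c - (q + d)%:R * x,
      c - (q + d)%:R * x < pi & 0 < c - d%:R * x < pi].
Proof.
move=> q0 /andP[c0 cpi] /andP[x0 xT].
have q1 : 1 <= q%:R :> R by rewrite ler1n.
have d1 : 0 <= d%:R :> R by [].
have s1 : 0 < q%:R + d%:R :> R by rewrite ltr_wpDr // ltr0n.
have xs : x * (q%:R + d%:R) <= c by rewrite -ler_pdivlMr // -natrD.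
rewrite natrD; have x1 := @pi_gt0 R; split; [nra|nra|nra|nra|].
apply/andP; split; last nra.
case: (ltgtP 0 x) x0 => // [x0|<-] _; last by rewrite mulr0 subr0.
nra.
Qed.

Lemma sine_triangle_pos {R : realType} (q d : nat) (c x : R) :
  (0 < q)%N -> 0 < c < pi -> 0 <= x <= c / (q + d)%:R ->
  [/\ 0 <= sin (q%:R * x), 0 <= sin (c - (q + d)%:R * x),
      0 < sin (c - d%:R * x), 0 < x -> 0 < sin (q%:R * x)
    & x < c / (q + d)%:R -> 0 < sin (c - (q + d)%:R * x)].
Proof.
move=> q0 cI xI; have [h1 h2 h3 h4 h5] := @sine_triangle_bounds R q d c x q0 cI xI.
split.
- by rewrite sin_ge0_pi // h1 ltW.
- by rewrite sin_ge0_pi // h3 ltW.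
- exact: sin_gt0_pi.
- by move=> x0; apply: sin_gt0_pi; rewrite h2 andbT mulr_gt0 ?ltr0n.
- move=> xT; apply: sin_gt0_pi; rewrite h4 andbT subr_gt0 mulrC.
  by rewrite -ltr_pdivlMr // ltr0n addn_gt0 q0.
Qed.

Lemma is_derive_sin_affine {R : realType} (a b x : R) :
  is_derive x 1 (fun y => sin (a + b * y)) (cos (a + b * x) * b).
Proof.
apply: (@is_derive1_comp R sin (fun y => a + b * y)).
have h : is_derive x 1 (cst a + b *: (id : R -> R)) (0 + b *: 1).
  exact: is_deriveD.
by rewrite add0r /GRing.scale /= mulr1 in h; exact: h.
Qed.

(** With [a = q x] and [b = c - (q + d) x] this is the numerator of the logarithmic derivative of
    the ratio in [sine_ratio_mono]. It is a sum of two squares because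
    [q^2 + (q + d)^2 - d^2 = 2 q (q + d)]. *)
Lemma sine_triangle_log_derivative_gt0 {R : realType} (q d : nat) (a b : R) :
  0 < d%:R :> R -> 0 < sin a -> 0 < sin b ->
  0 < q%:R ^+ 2 * cos a * sin b * sin (a + b)
      + (q + d)%:R ^+ 2 * cos b * sin a * sin (a + b)
      - d%:R ^+ 2 * cos (a + b) * sin a * sin b.
Proof.
move=> d0 sa sb.
have -> : q%:R ^+ 2 * cos a * sin b * sin (a + b)
      + (q + d)%:R ^+ 2 * cos b * sin a * sin (a + b)
      - d%:R ^+ 2 * cos (a + b) * sin a * sin b
   = (q%:R * cos a * sin b + (q + d)%:R * cos b * sin a) ^+ 2
     + (d%:R * sin a * sin b) ^+ 2.
  by rewrite natrD sinD cosD; ring.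
by rewrite ltr_wpDl ?sqr_ge0 // exprn_gt0 // !mulr_gt0.
Qed.

Lemma sine_ratio_mono {R : realType} (q d : nat) (c x y : R) :
  (0 < q)%N -> (0 < d)%N -> 0 < c < pi ->
  0 <= x -> x < y -> y <= c / (q + d)%:R ->
  sin (q%:R * x) ^+ q * sin (c - d%:R * x) ^+ d
    * sin (c - (q + d)%:R * y) ^+ (q + d)
  < sin (q%:R * y) ^+ q * sin (c - d%:R * y) ^+ d
    * sin (c - (q + d)%:R * x) ^+ (q + d).
Proof.
move=> q0 d0 cI x0 xy yT; set T := c / (q + d)%:R in yT *.
have q0' : 0 < q%:R :> R by rewrite ltr0n.
have d0' : 0 < d%:R :> R by rewrite ltr0n.
have s0 : (0 < q + d)%N by rewrite addn_gt0 q0.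
have pos z (zI : 0 <= z <= T) := @sine_triangle_pos R q d c z q0 cI zI.
have y0 : 0 < y by exact: le_lt_trans xy.
have xT : x < T by exact: lt_le_trans yT.
have [_ _ sCx sAx sBx] := pos x (ltac:(by rewrite x0 ltW)).
have [_ _ sCy sAy sBy] := pos y (ltac:(by rewrite ltW)).
have Npos : 0 < sin (q%:R * y) ^+ q * sin (c - d%:R * y) ^+ d
    * sin (c - (q + d)%:R * x) ^+ (q + d).
  by rewrite !mulr_gt0 // exprn_gt0 ?sAy ?sBx.
(* At [x = 0] or [y = T] the left side vanishes while the right side is positive. Treating these
   cases first leaves an interval on which all three sines are positive and the quotient [h] is
   differentiable. *)
have [xz|xz] := eqVneq x 0.
  by rewrite {1}xz mulr0 sin0 expr0n gtn_eqF // !mul0r.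
have [yz|yz] := eqVneq y T.
  suff -> : sin (c - (q + d)%:R * y) = 0 by rewrite expr0n gtn_eqF // mulr0.
  by rewrite yz /T mulrC divfK ?subrr ?sin0 // pnatr_eq0 -lt0n.
have {}x0 : 0 < x by rewrite lt_neqAle eq_sym xz.
have {}yT : y < T by rewrite lt_neqAle yz.
pose A (z : R) := sin (0 + q%:R * z).
pose B (z : R) := sin (c + - (q + d)%:R * z).
pose C (z : R) := sin (c + - d%:R * z).
pose h := (A ^+ q * C ^+ d) * (fun z => ((B ^+ (q + d)) z)^-1).
have AE z : A z = sin (q%:R * z) by rewrite /A add0r.
have BE z : B z = sin (c - (q + d)%:R * z) by rewrite /B mulNr.
have CE z : C z = sin (c - d%:R * z) by rewrite /C mulNr.
have ABC z : 0 < z < T -> [/\ 0 < A z, 0 < B z & 0 < C z].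
  move=> /andP[z0 zT]; have [_ _ h1 h2 h3] := pos z (ltac:(by rewrite !ltW)).
  by rewrite AE BE CE; split; [exact: h2|exact: h3|].
suff : h x < h y.
  have [_ Bx _] := ABC x (ltac:(by rewrite x0)).
  have [_ By _] := ABC y (ltac:(by rewrite y0)).
  rewrite /h /= !fctE /= ltr_pdivlMr ?exprn_gt0 // mulrAC.
  by rewrite ltr_pdivrMr ?exprn_gt0 // AE BE CE AE BE CE.
have dh z : 0 < z < T -> exists2 l : R, 0 < l & is_derive z 1 h l.
  move=> zI; have [Az Bz Cz] := ABC z zI.
  have dA := is_derive_sin_affine 0 q%:R z.
  have dB := is_derive_sin_affine c (- (q + d)%:R) z.
  have dC := is_derive_sin_affine c (- d%:R) z.
  have Bn0 : (B ^+ (q + d)) z != 0 by rewrite /= fctE expf_neq0 // gt_eqF.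
  have dhz := is_deriveM (is_deriveM (is_deriveX q dA) (is_deriveX d dC))
    (is_deriveV Bn0 (is_deriveX (q + d) dB)).
  eexists; last exact: dhz.
  have := @sine_triangle_log_derivative_gt0 R q d (q%:R * z)
    (c - (q + d)%:R * z) d0'.
  have -> : q%:R * z + (c - (q + d)%:R * z) = c - d%:R * z by rewrite natrD; ring.
  rewrite -AE -BE -CE => /(_ Az Bz); set K := (X in 0 < X -> _) => K0.
  (* The derivative produced by the product, power and inverse rules is the numerator [K] times a
     positive factor. *)
  rewrite [ltRHS](_ : _ = A z ^+ q.-1 * C z ^+ d.-1 * B z ^+ (q + d).-1
     / (B z ^+ (q + d)) ^+ 2 * K); first by rewrite !mulr_gt0 ?invr_gt0 ?exprn_gt0.
  have XE (f : R -> R) k : (f ^+ k) z = f z ^+ k by rewrite fctE.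
  have pr (r : R) k : (0 < k)%N -> r ^+ k = r * r ^+ k.-1.
    by move=> k0; rewrite -exprS prednK.
  have ME (f g : R -> R) : (f * g) z = f z * g z by rewrite fctE.
  rewrite /K /GRing.scale /= ME !XE -/(A z) -/(B z) -/(C z) !add0r !mulNr.
  rewrite (pr (A z)) // (pr (C z)) // (pr (B z)) //.
  by field; rewrite expf_neq0 gt_eqF.
apply: (@gtr0_derive1_lt_cc R h x y); rewrite ?in_itv /= ?lexx ?ltW //.
- move=> z; rewrite in_itv /= => /andP[xz' zy].
  by have [|l _ []] := dh z; rewrite ?(lt_trans x0 xz') ?(lt_trans zy).
- move=> z; rewrite in_itv /= => /andP[xz' zy].
  have [|l l0 [_ e]] := dh z; rewrite ?(lt_trans x0 xz') ?(lt_trans zy) //.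
  by rewrite derive1E e.
- apply: derivable_within_continuous => z; rewrite in_itv /= => /andP[xz' zy].
  by have [|l _ []] := dh z; rewrite ?(lt_le_trans x0 xz') ?(le_lt_trans zy).
Qed.

(** Here [f] is the angle parameter and [r] the modulus; the two equations are the law of sines.
    Both functions are built from [clamp01 a], so they are continuous everywhere while the equations
    hold on the unit interval. *)
Lemma sine_triangle_curve {R : realType} (q d : nat) (c : R) :
  (0 < q)%N -> (0 < d)%N -> 0 < c < pi ->
  exists f r : R -> R, [/\ continuous f, continuous r,
    forall a, 0 <= f a <= c / (q + d)%:R, forall a, 0 < r a
    & [/\ forall a, 0 <= a <= 1 ->
        sin (c - (q + d)%:R * f a) / sin (c - d%:R * f a) * r a ^+ q = 1 - a
        /\ sin (q%:R * f a) / sin (c - d%:R * f a) * r a ^+ (q + d) = a,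
      f 0 = 0, f 1 = c / (q + d)%:R, r 0 = 1 & r 1 = 1]].
Proof.
move=> q0 d0 cI; set T := c / (q + d)%:R.
have s0 : (0 < q + d)%N by rewrite addn_gt0 q0.
have sn0 : (q + d)%:R != 0 :> R by rewrite pnatr_eq0 -lt0n.
have T0 : 0 < T by rewrite divr_gt0 ?ltr0n //; case/andP: cI.
have sT : (q + d)%:R * T = c by rewrite /T mulrC divfK.
have pos z (zI : 0 <= z <= T) := @sine_triangle_pos R q d c z q0 cI zI.
have c_aff (a b : R) : continuous (fun z => sin (a + b * z)).
  move=> z; apply: differentiable_continuous; apply/derivable1_diffP.
  by case: (is_derive_sin_affine a b z).
have c_A : continuous (fun z : R => sin (q%:R * z)).
  by under eq_fun do rewrite -[_ * _]add0r; exact: c_aff.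
have c_B : continuous (fun z : R => sin (c - (q + d)%:R * z)).
  by under eq_fun do rewrite -mulNr; exact: c_aff.
have c_C : continuous (fun z : R => sin (c - d%:R * z)).
  by under eq_fun do rewrite -mulNr; exact: c_aff.
have c_X (g : R -> R) k : continuous g -> continuous (fun z => g z ^+ k).
  by move=> cg z; exact: (continuous_comp (cg z) (@exprn_continuous _ k _)).
(* Eliminating [r] between the [(q + d)]-th power of the first equation and the [q]-th power of the
   second gives [u a * M (f a) = v a * N (f a)]. *)
pose N (z : R) := sin (q%:R * z) ^+ q * sin (c - d%:R * z) ^+ d.
pose M (z : R) := sin (c - (q + d)%:R * z) ^+ (q + d).
pose u (a : R) := clamp01 a ^+ q.
pose v (a : R) := (1 - clamp01 a) ^+ (q + d).
have w0 (a : R) : 0 <= clamp01 a by case/andP: (clamp01_itv a).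
have w1 (a : R) : 0 <= 1 - clamp01 a by rewrite subr_ge0; case/andP: (clamp01_itv a).
have [||||||||||||f [cf fT fE f0 f1]] := @balance_continuous R T N M u v T0.
- by move=> z; apply: cvgM; exact: c_X.
- exact: c_X.
- by apply: c_X; exact: continuous_clamp01.
- apply: c_X => z; apply: cvgB; first exact: cvg_cst.
  exact: continuous_clamp01.
- by move=> z /pos[h1 h2 h3 _ _]; rewrite mulr_ge0 ?exprn_ge0 // ltW.
- by move=> z /pos[h1 h2 h3 _ _]; rewrite exprn_ge0.
- by rewrite /N mulr0 sin0 expr0n gtn_eqF // mul0r.
- by rewrite /M sT subrr sin0 expr0n gtn_eqF.
- by move=> z w; exact: sine_ratio_mono.
- by move=> a; rewrite exprn_ge0.
- by move=> a; rewrite exprn_ge0.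
- move=> a; rewrite lt_neqAle addr_ge0 ?exprn_ge0 // andbT eq_sym.
  rewrite paddr_eq0 ?exprn_ge0 // !expf_eq0 q0 s0 /= subr_eq0.
  by apply/negP => /andP[/eqP -> ]; rewrite oner_eq0.
have w_0 : clamp01 (0 : R) = 0 by rewrite clamp01_id // lexx ler01.
have w_1 : clamp01 (1 : R) = 1 by rewrite clamp01_id // lexx ler01.
have f00 : f 0 = 0 by apply: f0; rewrite /u w_0 expr0n gtn_eqF.
have f11 : f 1 = T by apply: f1; rewrite /v w_1 subrr expr0n gtn_eqF.
pose X (z : R) := sin (c - (q + d)%:R * z) / sin (c - d%:R * z).
pose Y (z : R) := sin (q%:R * z) / sin (c - d%:R * z).
have sc : sin c != 0 by rewrite gt_eqF // sin_gt0_pi.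
have X0 : X 0 = 1 by rewrite /X !mulr0 !subr0 divff.
have Y0 : Y 0 = 0 by rewrite /Y mulr0 sin0 mul0r.
have XT : X T = 0 by rewrite /X sT subrr sin0 mul0r.
have YT : Y T = 1.
  have -> : Y T = sin (q%:R * T) / sin (q%:R * T).
    by rewrite /Y; congr (_ / sin _); rewrite -[in LHS]sT natrD; ring.
  have [|_ _ _ + _] := pos T; first by rewrite lexx ltW.
  by move=> /(_ T0) ?; rewrite divff // gt_eqF.
have exr a : exists r : R, [/\ 0 < r, X (f a) * r ^+ q = 1 - clamp01 a
    & Y (f a) * r ^+ (q + d) = clamp01 a].
  have := fE a; rewrite /u /v; set w := clamp01 a => e.
  have [_ _ sC _ _] := pos _ (fT a).
  have C0 : sin (c - d%:R * f a) != 0 by rewrite gt_eqF.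
  (* At the ends [w = 0] and [w = 1] one of [X], [Y] vanishes and the other equals [1], so [r = 1].
     In between both are positive and [r] is the [q]-th root solving the first equation. *)
  have [wE|wn0] := eqVneq w 0.
    have faE : f a = 0.
      apply: f0; rewrite /u -/w wE expr0n gtn_eqF //.
    by exists 1; rewrite faE X0 Y0 wE expr1n mul1r subr0 mul0r.
  have [wE|wn1] := eqVneq w 1.
    have faE : f a = T.
      by apply: f1; rewrite /v -/w wE subrr expr0n gtn_eqF.
    by exists 1; rewrite faE XT YT wE !expr1n mul1r subrr mul0r.
  have wp : 0 < w by rewrite lt_neqAle eq_sym wn0 w0.
  have wp1 : 0 < 1 - w by rewrite lt_neqAle eq_sym subr_eq0 eq_sym wn1 w1.
  have f_gt0 : 0 < f a.
    have /andP[f_ge0 _] := fT a; rewrite lt_neqAle f_ge0 andbT eq_sym.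
    apply/eqP => fa0; move: e; rewrite fa0 /N /M !mulr0 !subr0 sin0.
    rewrite expr0n gtn_eqF // mul0r mulr0 => /eqP.
    by rewrite mulf_eq0 !expf_eq0 (negPf wn0) (negPf sc) !andbF.
  have f_ltT : f a < T.
    have /andP[_ f_leT] := fT a; rewrite lt_neqAle f_leT andbT.
    apply/eqP => faT; move: e; rewrite faT /M sT subrr sin0 expr0n gtn_eqF //.
    rewrite mulr0 => /esym/eqP; rewrite mulf_eq0 gt_eqF ?exprn_gt0 //= gt_eqF //.
    have [|_ _ sC' sA' _] := pos T; first by rewrite lexx ltW.
    by rewrite mulr_gt0 ?exprn_gt0 ?sA'.
  have [_ _ _ sA sB] := pos _ (fT a).
  have {}sA := sA f_gt0; have {}sB := sB f_ltT.
  have Xp : 0 < X (f a) by rewrite divr_gt0.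
  have Yp : 0 < Y (f a) by rewrite divr_gt0.
  have [r r_gt0 rE] := @root_of_pos R q ((1 - w) / X (f a)) q0 (divr_gt0 wp1 Xp).
  exists r; split=> //; first by rewrite rE mulrC divfK ?gt_eqF.
  (* Both sides are nonnegative, so [q]-th powers may be compared; only [r ^+ q] then occurs, and
     the second equation turns into the balance [e]. *)
  apply/eqP; rewrite -(@eqrXn2 R q) //; last 2 first.
  - by rewrite mulr_ge0 ?exprn_ge0 // ltW.
  - exact: ltW.
  rewrite exprMn exprAC rE /X /Y !expr_div_n invf_div.
  rewrite [sin (c - d%:R * f a) ^+ (q + d)]exprD; apply/eqP.
  transitivity ((1 - w) ^+ (q + d) * N (f a) / M (f a)).
    by rewrite /N /M; field; rewrite !expf_neq0 ?gt_eqF.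
  by rewrite -e mulfK // expf_neq0 // gt_eqF.
have [r rP] := choice exr; exists f, r.
have r_1 a k : (0 < k)%N -> r a ^+ k = 1 -> r a = 1.
  have [/ltW r0 _ _] := rP a; move=> k0 /eqP.
  by rewrite pexpr_eq1 // => /eqP.
have r0 : r 0 = 1.
  by apply: (r_1 0 q q0); have [_ + _] := rP 0; rewrite f00 X0 w_0 mul1r subr0.
have r1 : r 1 = 1.
  by apply: (r_1 1 _ s0); have [_ _] := rP 1; rewrite f11 YT w_1 mul1r.
split=> //; try by move=> a; case: (rP a).
(* The choice of [r] carries no continuity by itself; the sum of the two equations,
   [X r^q + Y r^(q + d) = 1], supplies it. *)
- apply: (@trinomial_root_continuous R (X \o f) (Y \o f) r q (q + d)) => //.
  + move=> a; apply: cvgM; first exact: (continuous_comp (cf a) (@c_B _)).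
    apply: cvgV; last exact: (continuous_comp (cf a) (@c_C _)).
    by have [_ _ h _ _] := pos _ (fT a); rewrite gt_eqF.
  + move=> a; apply: cvgM; first exact: (continuous_comp (cf a) (@c_A _)).
    apply: cvgV; last exact: (continuous_comp (cf a) (@c_C _)).
    by have [_ _ h _ _] := pos _ (fT a); rewrite gt_eqF.
  + by move=> a; have [_ h1 h2 _ _] := pos _ (fT a); rewrite divr_ge0 // ltW.
  + by move=> a; have [h1 _ h2 _ _] := pos _ (fT a); rewrite divr_ge0 // ltW.
  + by move=> a; case: (rP a).
  + by move=> a; have [_ -> ->] := rP a; rewrite subrK.
- split=> //.
  by move=> a aI; have [_ rX rY] := rP a; rewrite -/(X _) -/(Y _) rX rY clamp01_id.
Qed.

(** * Polar form, principal argument and complex-valued continuity *)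

Definition expi {R : realType} (x : R) : R[i] := cos x +i* sin x.

Lemma expiD {R : realType} (x y : R) : expi (x + y) = expi x * expi y.
Proof. by apply/eqP; rewrite eq_complex /= cosD sinD eqxx addrC eqxx. Qed.

Lemma expi0 {R : realType} : expi (0 : R) = 1.
Proof. by rewrite /expi cos0 sin0. Qed.

Lemma expiX {R : realType} (x : R) n : expi x ^+ n = expi (n%:R * x).
Proof.
elim: n => [|n IHn]; first by rewrite expr0 mul0r expi0.
by rewrite exprS IHn -expiD -[in RHS]natr1 mulrDl mul1r addrC.
Qed.

Lemma expi_2pi_nat {R : realType} n : expi (2 * pi * n%:R : R) = 1.
Proof.
by rewrite mulrC -expiX /expi mulr_natl cos2pi sin2pi expr1n.
Qed.

Lemma normc_expi {R : realType} (rho x : R) : 0 < rho ->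
  `|rho%:C * expi x| = rho%:C.
Proof.
move=> rho0; rewrite normc_def /=; congr (_%:C).
rewrite !mul0r subr0 addr0 -[RHS]gtr0_norm // -sqrtr_sqr; congr Num.sqrt.
by rewrite !exprMn -mulrDr cos2Dsin2 mulr1.
Qed.

Lemma Arg_expi {R : realType} (rho theta : R) : 0 < rho ->
  - pi < theta <= pi -> Arg (rho%:C * expi theta) = theta.
Proof.
move=> rho0 tI; apply: Arg_uniq => //; last first.
  by rewrite /is_argument normc_expi.
by rewrite -normr_eq0 normc_expi // eq_complex /= gt_eqF.
Qed.

Lemma continuous_complex {R : realType} (f g : R -> R) :
  continuous f -> continuous g ->
  continuous (fun a => (f a +i* g a) : R[i]^o).
Proof.
move=> cf cg a; apply/cvgrPdist_lt => e e0.
(* The radius [e] ranges over [R[i]], where being positive includes being real. *)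
have [re_e im_e] : 0 < complex.Re e /\ complex.Im e = 0.
  by move: e0; rewrite ltcE /= => /andP[/eqP -> ->].
have e2 : 0 < complex.Re e / 2 by rewrite divr_gt0.
have eE : e = (complex.Re e)%:C by apply/eqP; rewrite eq_complex /= im_e !eqxx.
near=> y.
have hf : `|f a - f y| < complex.Re e / 2.
  by near: y; move/cvgrPdist_lt: (cf a) => /(_ _ e2).
have hg : `|g a - g y| < complex.Re e / 2.
  by near: y; move/cvgrPdist_lt: (cg a) => /(_ _ e2).
rewrite eE (_ : _ - _ = (f a - f y)%:C + (0 +i* (g a - g y))); last first.
  by apply/eqP; rewrite eq_complex /= addr0 add0r !eqxx.
rewrite (le_lt_trans (ler_normD _ _)) //.
rewrite !normc_def /= expr0n /= addr0 add0r !sqrtr_sqr -rmorphD ltcR.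
by rewrite [ltRHS]splitr ltrD.
Unshelve. all: by end_near. Qed.

(** * Roots of the Ito polynomial along the curve *)

Lemma ito_poly_horner {R : realType} q s (a : R) (z : R[i]) :
  (ito_poly q s a).[z] = z ^+ s - (1 - a)%:C * z ^+ (s - q) - a%:C.
Proof. by rewrite /ito_poly !hornerE. Qed.

(** Put [B = c - (q + d) x] and [C = c - d x]. Up to the factor [rho ^+ (q + d) / sin C], and
    conjugation when [eps = -1], the claim is [sin C e^(-iB) - sin B e^(-iC) = sin (C - B)]. The
    angle hypotheses are stated through [expi] because they hold only modulo [2 pi]. *)
Lemma ito_poly_root {R : realType} (q d : nat) (a c x eps rho theta : R) :
  eps = 1 \/ eps = -1 -> sin (c - d%:R * x) != 0 ->
  expi (q%:R * theta) = expi (eps * (q%:R * x)) ->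
  expi ((q + d)%:R * theta) = expi (- eps * (c - (q + d)%:R * x)) ->
  sin (c - (q + d)%:R * x) / sin (c - d%:R * x) * rho ^+ q = 1 - a ->
  sin (q%:R * x) / sin (c - d%:R * x) * rho ^+ (q + d) = a ->
  (ito_poly q (q + d) a).[rho%:C * expi theta] = 0.
Proof.
move=> eps1 sC0 eq es aX aY.
have ed : expi (d%:R * theta) = expi (- eps * (c - d%:R * x)).
  transitivity (expi ((q + d)%:R * theta) * expi (- (q%:R * theta))).
    by rewrite -expiD natrD; congr expi; ring.
  have inv (y : R) : expi (- y) = (expi y)^-1.
    have h : expi y * expi (- y) = 1 by rewrite -expiD subrr expi0.
    have u : expi y \is a GRing.unit.
      by rewrite unitfE; apply/eqP => z; move/eqP: h; rewrite z mul0r eq_sym oner_eq0.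
    by rewrite -[LHS](mulKr u) h mulr1.
  by rewrite inv eq es -inv -expiD natrD; congr expi; ring.
rewrite ito_poly_horner addKn !exprMn !expiX es ed -!rmorphXn /=.
set B := c - (q + d)%:R * x in es aX *; set C := c - d%:R * x in sC0 ed aX aY *.
have AE : q%:R * x = C - B by rewrite /C /B natrD; ring.
have epsE (y : R) : cos (- eps * y) = cos y /\ sin (- eps * y) = - eps * sin y.
  by case: eps1 => ->; rewrite ?opprK ?mul1r ?mulN1r ?cosN ?sinN.
rewrite /expi !(epsE _).1 !(epsE _).2 -aX -[in X in _ - X]aY AE sinB exprD.
by apply/eqP; rewrite eq_complex /= !mul0r !subr0 !addr0; apply/andP; split;
  apply/eqP; field.
Qed.

Lemma farey_neighbors_det {R : realType} (n p q r s : nat) :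
  farey_neighbors n p q r s ->
  let eps : R := r%:R * q%:R - p%:R * s%:R in eps = 1 \/ eps = -1.
Proof.
move=> [fp fr [/(farey_pair_det _ _ _ _ _ fp fr) e|/(farey_pair_det _ _ _ _ _ fr fp) e]] /=;
  rewrite -!natrM e natrD; [left|right]; by rewrite ?natrM; ring.
Qed.

Theorem theorem4p6 (R : realType) (n p q r s : nat)
    (hn : (4 <= n)%N)
    (hF : farey_neighbors n p q r s)
    (hqs : (q < s)%N)
    (hfloor : (n %/ q)%N = 1%N)
    (hmin : 0 < Num.min (p%:R / q%:R : rat) (r%:R / s%:R))
    (hminmax : Num.min (p%:R / q%:R : rat) (r%:R / s%:R)
               < Num.max (p%:R / q%:R) (r%:R / s%:R))
    (hmax : Num.max (p%:R / q%:R : rat) (r%:R / s%:R) < 1 / 2) :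
  exists lambda : R -> R[i]^o,
    [/\ {within `[0, 1], continuous lambda},
        lambda 0 = omega R q ^+ p,
        lambda 1 = omega R s ^+ r,
        forall alpha : R, 0 <= alpha <= 1 ->
          (ito_poly q s alpha).[lambda alpha] = 0
      & forall alpha : R, 0 < alpha < 1 ->
          Num.min (p%:R / q%:R) (r%:R / s%:R)
            <= Arg (lambda alpha) / (2 * pi)
            <= Num.max (p%:R / q%:R) (r%:R / s%:R)].
Proof.
have eps1 := @farey_neighbors_det R _ _ _ _ _ hF.
move: eps1; set eps := (_ - _) => /= eps1.
move: hmin hmax; rewrite lt_min gt_max => /andP[p0 r0] /andP[p12 r12].
have pos a b : 0 < a%:R / b%:R :> rat -> (0 < a)%N && (0 < b)%N.
  by case: a b => [|a] [|b]; rewrite ?mul0r ?invr0 ?mulr0 ?ltxx.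
have /andP[{}p0 q0] := pos _ _ p0; have /andP[{}r0 s0] := pos _ _ r0.
have half : 1 / 2 = 1%:R / 2%:R :> rat by [].
move: p12 r12; rewrite half !ltr_nat_div // => p12 r12.
have [d d0 sE] : exists2 d, (0 < d)%N & s = (q + d)%N.
  by exists (s - q)%N; [rewrite subn_gt0|rewrite subnKC // ltnW].
have qR : 0 < q%:R :> R by rewrite ltr0n.
have sR : 0 < s%:R :> R by rewrite ltr0n.
have qn0 : q%:R != 0 :> R by rewrite gt_eqF.
have sn0 : s%:R != 0 :> R by rewrite gt_eqF.
have pi0 := @pi_gt0 R.
pose c : R := 2 * pi / q%:R.
(* From [0 < p] and [p / q < 1 / 2] follows [q > 2], hence [c < pi]. *)
have cI : 0 < c < pi.
  rewrite divr_gt0 ?mulr_gt0 //= ltr_pdivrMr // mulrC ltr_pM2l //.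
  by rewrite (ltr_nat R 2); lia.
have [f [rho [cf crho fT rho0 [eqs f0 f1 rho_0 rho_1]]]] :=
  @sine_triangle_curve R q d c q0 d0 cI.
rewrite -sE in fT f1 eqs.
pose theta a := 2 * pi * p%:R / q%:R + eps * f a.
have thetaE a : theta a / (2 * pi) = p%:R / q%:R + eps * (f a / (2 * pi)).
  rewrite /theta; have := lt0r_neq0 pi0; move: (@pi R) => P P0.
  by field; rewrite P0.
(* Since [r q - p s = eps], the fractions differ by [eps / (q s)], which is the displacement of
   [theta / (2 pi)] when [f] reaches its maximum [c / s]. *)
have rsE : r%:R / s%:R = p%:R / q%:R + eps * (c / s%:R / (2 * pi)).
  rewrite (_ : r%:R = (p%:R * s%:R + eps) / q%:R) /c; last first.
    by rewrite /eps addrC subrK mulfK // gt_eqF.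
  have := lt0r_neq0 pi0; move: (@pi R) => P P0.
  by field; rewrite sn0 P0.
have pi2 : 0 < 2 * pi :> R by rewrite mulr_gt0.
have thetaI a : Num.min (p%:R / q%:R) (r%:R / s%:R)
    <= theta a / (2 * pi) <= Num.max (p%:R / q%:R) (r%:R / s%:R).
  have /andP[fa0 faT] := fT a.
  have x0 : 0 <= f a / (2 * pi) by rewrite divr_ge0 // ltW.
  have xT : f a / (2 * pi) <= c / s%:R / (2 * pi) by rewrite ler_pM2r ?invr_gt0.
  rewrite rsE thetaE ge_min le_max.
  case: eps1 => ->; rewrite ?mul1r ?mulN1r !lerD2l ?lerN2 ?oppr_le0.
    by rewrite lerDl x0 xT orbT.
  by rewrite gerDl oppr_le0 x0 xT orbT.
(* Both fractions lie strictly between [0] and [1 / 2], so [theta a] lies in the principal range and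
   is the value of [Arg]. *)
have theta_pi a : - pi < theta a <= pi.
  have /andP[lo hi] := thetaI a.
  have lo0 : 0 < theta a / (2 * pi).
    by apply: lt_le_trans lo; rewrite lt_min !divr_gt0 ?ltr0n.
  have hi0 : theta a / (2 * pi) < 1 / 2.
    apply: le_lt_trans hi _; rewrite gt_max -(_ : 1%:R / 2%:R = 1 / 2) //.
    by rewrite !ltr_nat_div // p12.
  have th0 : 0 < theta a by rewrite -[theta a](divfK (lt0r_neq0 pi2)) pmulr_lgt0.
  rewrite ltr_pdivrMr // in hi0; apply/andP; split; first by lra.
  by rewrite ltW // (lt_le_trans hi0) // mulrA; lra.
exists (fun a => (rho a * cos (theta a)) +i* (rho a * sin (theta a))).
have lamE a : (rho a * cos (theta a)) +i* (rho a * sin (theta a))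
    = (rho a)%:C * expi (theta a).
  by apply/eqP; rewrite eq_complex /= !mul0r subr0 addr0 !eqxx.
have qth a : q%:R * theta a = 2 * pi * p%:R + eps * (q%:R * f a).
  by rewrite /theta; move: (@pi R) => P; field.
(* The relation [p s = r q - eps] turns [2 pi p s / q] into [2 pi r - eps c]. *)
have sth a : s%:R * theta a = 2 * pi * r%:R + - eps * (c - s%:R * f a).
  rewrite /theta /c; apply: (mulfI qn0).
  have -> : 2 * pi * r%:R = 2 * pi * ((p%:R * s%:R + eps) / q%:R).
    by rewrite /eps addrC subrK mulfK // gt_eqF.
  by move: (@pi R) => P; field.
split.
- apply: continuous_subspaceT; apply: continuous_complex => a.
    apply: cvgM; first exact: crho.
    apply: (continuous_comp _ (@continuous_cos R _)).
    by apply: cvgD; [exact: cvg_cst|apply: cvgM; [exact: cvg_cst|exact: cf]].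
  apply: cvgM; first exact: crho.
  apply: (continuous_comp _ (@continuous_sin R _)).
  by apply: cvgD; [exact: cvg_cst|apply: cvgM; [exact: cvg_cst|exact: cf]].
- rewrite lamE rho_0 mul1r /omega -/(expi _) expiX; congr expi.
  by rewrite /theta f0 mulr0 addr0; move: (@pi R) => P; ring.
- rewrite lamE rho_1 mul1r /omega -/(expi _) expiX; congr expi.
  apply: (mulfI sn0); rewrite sth f1 [s%:R * (c / _)]mulrC divfK ?gt_eqF //.
  by move: (@pi R) => P; field.
- move=> a /eqs[aX aY]; rewrite lamE sE.
  apply: (ito_poly_root q d a c (f a) eps) => //.
  + have [_ _ h _ _] := @sine_triangle_pos R q d c (f a) q0 cI (ltac:(by rewrite -sE)).
    by rewrite gt_eqF.
  + by rewrite qth expiD expi_2pi_nat mul1r.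
  + by rewrite -sE sth expiD expi_2pi_nat mul1r.
  + by rewrite -sE.
  + by rewrite -sE.
- by move=> a _; rewrite lamE Arg_expi.
Qed.
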